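(* Let $\mathcal{V}$ be a finite-dimensional vector space over a field of characteristic $\ell \ge 5$, and let $A$ be a unipotent linear operator on $\mathcal{V}$. Let $k$ be an integer with $2 \le k \le \dim(\mathcal{V})-2$, and suppose $(A-1)^{\ell-2} \ne 0$. Then $(\wedge^k(A)-1)^{\ell-1} \ne 0$.
   Context: $\wedge^k(A)$ denotes the linear operator on the $k$-th exterior power $\wedge^k(\mathcal{V})$ induced by $A$. *)

(* Defs.v *)
From HB Require Import structures.
From mathcomp Require Import all_boot all_order all_algebra all_fingroup.
Set Implicit Arguments. Unset Strict Implicit. Unset Printing Implicit Defensive.
Import GRing.Theory.
Local Open Scope ring_scope.

(* We work concretely with V = F^n (row vectors), A : 'M[F]_n.
   The k-th exterior power wedge^k(V) has the standard basis
   e_I = e_{i_1} /\ ... /\ e_{i_k}, indexed by k-subsets I = {i_1 < ... < i_k}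
   of 'I_n; the induced operator wedge^k(A) has, in this basis, the matrix of
   k x k minors of A (the k-th compound matrix). *)

Definition kset (n k : nat) := {S : {set 'I_n} | #|S| == k}.

(* increasing enumeration i_1 < ... < i_k of a k-subset *)
Definition kset_fun (n k : nat) (S : kset n k) : 'I_k -> 'I_n :=
  fun i => enum_val (cast_ord (esym (eqP (valP S))) i).

Definition wedge_mx (F : fieldType) (n k : nat) (A : 'M[F]_n)
  : 'M[F]_(#|{: kset n k}|) :=
  \matrix_(i, j) \det (mxsub (kset_fun (enum_val i)) (kset_fun (enum_val j)) A).

Definition unipotent (F : fieldType) (n : nat) (A : 'M[F]_n) : Prop :=
  exists m : nat, (A - 1) ^+ m = 0.

(* Main.v *)
(** By Cauchy-Binet, every function [i |-> \det (X *m A ^+ i *m Y)] is a matrix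
coefficient of the powers of [wedge_mx k A].  If it is a polynomial of exact
degree [l - 1] in [i], its [(l-1)]-st difference at [0], which is a matrix
coefficient of [(wedge_mx k A - 1) ^+ (l - 1)], is a nonzero multiple of
[(l - 1)`!].

For [k <= l - 3], take a chain [v, vN, ..., vN^d] with [N = A - 1], [d = l - 2]
and [vN^(d+1) = 0], and a vector [phi] with [vN^d phi != 0].  With the rows
[vN^r] and the columns [N^(d - c_s) phi], the [(r, s)] entry has degree
[c_s - r] in [i], and the top coefficient of the determinant is up to a nonzero
factor the Vandermonde determinant of the [c_s].  Its degree is
[\sum c_s - k(k-1)/2], which equals [l - 1] for [{1, ..., k-2, k, l-2}].

For larger [k], one passes to the quotient by a line fixed by [A], chosen so that
[N ^+ d] stays nonzero on the quotient, replacing [(n, k)] by [(n-1, k-1)]. *)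

Require Import Defs.
From HB Require Import structures.
From mathcomp Require Import all_boot all_order all_algebra all_fingroup zify.
Import GRing.Theory.
Local Open Scope ring_scope.

(** * The Cauchy-Binet formula and powers of compound matrices *)

Lemma det_noninj_rowsub (R : comPzRingType) (n k : nat) (Y : 'M[R]_(n, k))
    (f : 'I_k -> 'I_n) : ~~ injectiveb f -> \det (rowsub f Y) = 0.
Proof.
case/injectivePn=> i [j neq_ij eq_f].
by apply: (determinant_alternate neq_ij) => c; rewrite !mxE eq_f.
Qed.

Lemma kset_fun_inj (n k : nat) (S : kset n k) : injective (kset_fun S).
Proof. by move=> i j /enum_val_inj /cast_ord_inj. Qed.

Lemma kset_fun_in (n k : nat) (S : kset n k) (i : 'I_k) : kset_fun S i \in val S.
Proof. exact: enum_valP. Qed.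

Lemma kset_fun_surj (n k : nat) (S : kset n k) (x : 'I_n) :
  x \in val S -> exists i, kset_fun S i = x.
Proof.
move=> Sx; exists (cast_ord (eqP (valP S)) (enum_rank_in Sx x)).
by rewrite /kset_fun cast_ordK enum_rankK_in.
Qed.

Definition kset_perm_fun {n k : nat} (S : kset n k) (s : 'S_k) :
  {ffun 'I_k -> 'I_n} := [ffun i => kset_fun S (s i)].

Lemma kset_perm_fun_inj (n k : nat) (S : kset n k) : injective (kset_perm_fun S).
Proof.
move=> s t /ffunP eq_st; apply/permP => i.
by have := eq_st i; rewrite !ffunE => /kset_fun_inj.
Qed.

Lemma imset_injective_kset (n k : nat) (S : kset n k) :
  [set f : {ffun 'I_k -> 'I_n} | injectiveb f && (f @: 'I_k == val S)]
    = kset_perm_fun S @: 'S_k.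
Proof.
apply/setP => f; rewrite inE; apply/andP/imsetP => [[/injectiveP f_inj /eqP imf]|].
  have ex i : exists j, kset_fun S j = f i.
    by apply: kset_fun_surj; rewrite -imf imset_f.
  have [g gE] := fin_all_exists ex.
  have g_inj : injective g by move=> i j eq_g; apply: f_inj; rewrite -!gE eq_g.
  by exists (perm g_inj); rewrite ?inE //; apply/ffunP => i; rewrite ffunE permE gE.
case=> s _ ->; have s_inj : injective (kset_perm_fun S s).
  by move=> i j; rewrite !ffunE => /kset_fun_inj /perm_inj.
split; first exact/injectiveP.
rewrite eqEcard card_imset // card_ord (eqP (valP S)) leqnn andbT.
by apply/subsetP => _ /imsetP[i _ ->]; rewrite ffunE kset_fun_in.
Qed.

(** An injective function amounts to its image together with an ordering of that image. *)
Lemma big_injective_kset (R : nmodType) (n k : nat) (G : {ffun 'I_k -> 'I_n} -> R) :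
  \sum_(f : {ffun 'I_k -> 'I_n} | injectiveb f) G f
    = \sum_(S : kset n k) \sum_(s : 'S_k) G (kset_perm_fun S s).
Proof.
transitivity (\sum_(S : kset n k)
    \sum_(f : {ffun 'I_k -> 'I_n} | injectiveb f && (f @: 'I_k == val S)) G f).
  rewrite (exchange_big_dep (fun f : {ffun 'I_k -> 'I_n} => injectiveb f)) /=;
    last by move=> S f _ /andP[].
  apply: eq_bigr => f f_inj.
  have imf : #|f @: 'I_k| == k.
    by rewrite card_imset ?card_ord //; apply/injectiveP.
  rewrite (big_pred1 (Sub (f @: 'I_k) imf)) // => S.
  by rewrite f_inj /= -val_eqE /= eq_sym.
apply: eq_bigr => S _; rewrite -big_set imset_injective_kset big_imset /=.
  by apply: eq_bigl => s; rewrite inE.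
by move=> s t _ _; apply: kset_perm_fun_inj.
Qed.

(** Expanding along rows gives a sum over all functions [f]; those that repeat a value yield equal
    rows and vanish. The others are grouped by image, and reordering the rows of [Y] supplies the
    signs that form the minors of [X]. *)
Lemma cauchy_binet (R : comPzRingType) (n k : nat) (X : 'M[R]_(k, n)) (Y : 'M[R]_(n, k)) :
  \det (X *m Y) =
    \sum_(S : kset n k) \det (colsub (kset_fun S) X) * \det (rowsub (kset_fun S) Y).
Proof.
transitivity (\sum_(f : {ffun 'I_k -> 'I_n})
    (\prod_i X i (f i)) * \det (rowsub f Y)).
  transitivity (\sum_(s : 'S_k) \sum_(f : {ffun 'I_k -> 'I_n})
      (-1) ^+ s * \prod_i (X i (f i) * Y (f i) (s i))).
    apply: eq_bigr => s _; rewrite -mulr_sumr; congr (_ * _).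
    rewrite -(bigA_distr_bigA (fun i j => X i j * Y j (s i))) /=.
    by apply: eq_bigr => i _; rewrite mxE.
  rewrite exchange_big; apply: eq_bigr => f _; rewrite /determinant mulr_sumr.
  apply: eq_bigr => s _; rewrite big_split mulrCA; congr (_ * (_ * _)).
  by apply: eq_bigr => i _; rewrite mxE.
rewrite (bigID (fun f : {ffun 'I_k -> 'I_n} => injectiveb f)) /= [X in _ + X]big1 ?addr0.
  rewrite big_injective_kset; apply: eq_bigr => S _.
  rewrite [X in X * _]/determinant mulr_suml; apply: eq_bigr => s _.
  rewrite [X in _ = X * _]mulrC -mulrA; congr (_ * _).
    by apply: eq_bigr => i _; rewrite !mxE ffunE.
  rewrite -det_perm -det_mulmx -row_permE; congr (\det _).
  by apply/matrixP => i j; rewrite !mxE ffunE.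
by move=> f f_ninj; rewrite det_noninj_rowsub ?mulr0.
Qed.

(** By Cauchy-Binet, each factor [wedge_mx k A] turns the row of maximal minors of [X] into that of
    [X *m A]; one last use of the formula pairs this row with the minors of [Y]. *)
Lemma wedge_mxX_minors (F : fieldType) (n k : nat) (A : 'M[F]_n)
    (X : 'M[F]_(k, n)) (Y : 'M[F]_(n, k)) (i : nat) :
  ((\row_S \det (colsub (kset_fun (enum_val S)) X)) *m wedge_mx k A ^+ i
    *m (\col_S \det (rowsub (kset_fun (enum_val S)) Y))) 0 0
  = \det (X *m A ^+ i *m Y).
Proof.
have -> : (\row_S \det (colsub (kset_fun (enum_val S)) X)) *m wedge_mx k A ^+ i
    = \row_S \det (colsub (kset_fun (enum_val S)) (X *m A ^+ i)).
  elim: i => [|i IHi]; first by rewrite !expr0 -idmxE !mulmx1.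
  rewrite !exprSr -!mulmxE !mulmxA IHi; apply/rowP => T; rewrite !mxE.
  rewrite -mulmx_colsub cauchy_binet.
  rewrite -[RHS]/(\sum_(S in {: kset n k}) _) [RHS]big_enum_val /=.
  by apply: eq_bigr => S _; rewrite !mxE -mxsub_comp.
rewrite !mxE cauchy_binet -[RHS]/(\sum_(S in {: kset n k}) _) [RHS]big_enum_val /=.
by apply: eq_bigr => S _; rewrite !mxE.
Qed.

(** * Finite differences of polynomial sequences *)

Lemma size_coef_shift_sub (R : nzRingType) (m : nat) (f : {poly R}) :
  (size f <= m.+2)%N ->
  (size (f \Po ('X + 1) - f)%R <= m.+1)%N /\
  (f \Po ('X + 1) - f)`_m = f`_m.+1 *+ m.+1.
Proof.
move=> size_f.
have coefE e : (f \Po ('X + 1))`_e = \sum_(j < m.+2) f`_j *+ 'C(j, e).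
  rewrite coef_comp_poly (big_ord_widen _ (fun j => f`_j * (('X + 1) ^+ j)`_e) size_f).
  rewrite big_mkcond; apply: eq_bigr => j _.
  have -> : ('X + 1 : {poly R}) ^+ j = \poly_(i < j.+1) 'C(j, i)%:R.
    rewrite exprD1n poly_def; apply: eq_bigr => i _.
    by rewrite scaler_nat.
  rewrite coef_poly ltnS; case: leqP => [/(nth_default 0) ->|_]; first by rewrite mul0rn.
  by case: leqP => [_|/bin_small ->]; rewrite ?mulr_natr ?mulr0.
split.
  apply/leq_sizeP => e le_e; rewrite coefB coefE.
  rewrite big_ord_recr /= big1 => [|j _]; last first.
    by rewrite bin_small ?mulr0n // (leq_trans (ltn_ord j)).
  move: le_e; rewrite add0r leq_eqVlt => /predU1P[<-|lt_e].
    by rewrite binn mulr1n subrr.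
  by rewrite bin_small // mulr0n nth_default ?subr0 // (leq_trans size_f).
rewrite coefB coefE !big_ord_recr /= big1 => [|j _]; last by rewrite bin_small.
by rewrite add0r binn binSn mulr1n addrAC subrr add0r.
Qed.

Lemma poly_seq_difference (F : fieldType) (q m : nat) (B : 'M[F]_q)
    (x : 'rV[F]_q) (y : 'cV[F]_q) (f : {poly F}) :
  (size f <= m.+1)%N ->
  (forall i : nat, (x *m B ^+ i *m y) 0 0 = f.[i%:R]) ->
  (x *m (B - 1) ^+ m *m y) 0 0 = f`_m *+ m`!.
Proof.
elim: m y f => [|m IHm] y f size_f fE.
  move: (fE 0%N); rewrite !expr0 => ->.
  by rewrite (size1_polyC size_f) hornerC coefC.
have [size_g coef_g] := size_coef_shift_sub _ _ _ size_f.
(* One factor [B - 1] is absorbed into [y], which replaces [f] by its first difference; the top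
   coefficient gets multiplied by its degree, and these degrees build up the factorial. *)
rewrite exprSr -mulmxE mulmxA -mulmxA.
rewrite (IHm _ _ size_g) => [|i]; first by rewrite coef_g -mulrnA factS.
rewrite hornerD hornerN horner_comp !hornerE natr1 -!fE.
rewrite mulmxBl mulmxBr mul1mx exprSr -mulmxE !mulmxA.
by rewrite !mxE.
Qed.

(** * Falling factorials and top coefficients of determinants *)

(** The value at [i] is [r!] times a binomial coefficient, so this basis turns the expansion of
    [(1 + N) ^+ i] into a polynomial in [i]. *)
Definition falling_poly (R : comNzRingType) (r : nat) : {poly R} :=
  \prod_(a < r) ('X - (a%:R)%:P).

Lemma size_falling_poly (R : comNzRingType) (r : nat) : size (falling_poly R r) = r.+1.
Proof.
rewrite -[falling_poly R r]/(\prod_(a in 'I_r) _) -big_enum.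
by rewrite size_prod_XsubC size_enum_ord.
Qed.

Lemma coef_falling_poly (R : comNzRingType) (r : nat) : (falling_poly R r)`_r = 1.
Proof.
rewrite -[X in _`_X]/(r.+1.-1) -(size_falling_poly R r) -lead_coefE.
exact/monicP/monic_prod_XsubC.
Qed.

Lemma horner_falling_poly (R : comNzRingType) (r i : nat) :
  (falling_poly R r).[i%:R] = (i ^_ r)%:R.
Proof.
rewrite horner_prod; elim: r => [|r IHr]; first by rewrite big_ord0.
rewrite big_ord_recr /= IHr !hornerE ffactnSr natrM.
have [le_ri|lt_ir] := leqP r i; first by rewrite natrB.
by rewrite ffact_small // !mul0r.
Qed.

Lemma size_coef_prod (R : comNzRingType) (I : Type) (r : seq I)
    (p : I -> {poly R}) (c : I -> nat) :
  (forall i, size (p i) <= (c i).+1)%N ->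
  (size (\prod_(i <- r) p i)%R <= (\sum_(i <- r) c i).+1)%N /\
  (\prod_(i <- r) p i)`_(\sum_(i <- r) c i)%N = \prod_(i <- r) (p i)`_(c i).
Proof.
move=> size_p; elim: r => [|i r [IHs IHc]].
  by rewrite !big_nil size_poly1 coef1.
rewrite !big_cons; set q := \prod_(j <- r) p j in IHs IHc *.
set d := (\sum_(j <- r) c j)%N in IHs IHc *.
split.
  apply: leq_trans (size_polyMleq _ _) _.
  by rewrite -subn1 leq_subLR add1n -addSn -addnS leq_add.
have lt_ci : (c i < (c i + d).+1)%N by rewrite ltnS leq_addr.
rewrite coefM (bigD1 (Ordinal lt_ci)) //= addKn IHc [X in _ + X]big1 ?addr0 // => j.
rewrite -val_eqE /= neq_ltn => /orP[lt_j|lt_j].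
  rewrite [q`_ _]nth_default ?mulr0 //; apply: leq_trans IHs _.
  by rewrite ltn_subRL ltn_add2r.
by rewrite nth_default ?mul0r // (leq_trans (size_p i)).
Qed.

(** The bound depends only on the column, so every permutation contributes a product of the same
    formal degree. *)
Lemma size_coef_det (R : comNzRingType) (k : nat) (M : 'M[{poly R}]_k) (c : 'I_k -> nat) :
  (forall r s, size (M r s) <= (c s).+1)%N ->
  (size (\det M) <= (\sum_s c s).+1)%N /\
  (\det M)`_(\sum_s c s)%N = \det (\matrix_(r, s) (M r s)`_(c s)).
Proof.
move=> size_M.
have sumE (s : 'S_k) : (\sum_i c (s i) = \sum_i c i)%N.
  by rewrite [RHS](reindex_inj (@perm_inj _ s)).
have prodP (s : 'S_k) :=
  size_coef_prod _ _ (index_enum 'I_k) (fun i => M i (s i)) (c \o s) (fun i => size_M i (s i)).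
split.
  apply: leq_trans (size_sum _ _ _) _; apply/bigmax_leqP => s _.
  have [+ _] := prodP s; rewrite sumE.
  by case: (odd_perm s); rewrite ?expr1 ?expr0 ?mulN1r ?mul1r ?size_polyN.
rewrite coef_sum; apply: eq_bigr => s _; have [_] := prodP s; rewrite sumE => coefE.
have -> (p : {poly R}) e : ((-1) ^+ s * p)`_e = (-1) ^+ s * p`_e.
  by case: (odd_perm s); rewrite ?expr1 ?expr0 ?mulN1r ?mul1r ?coefN.
by rewrite coefE; congr (_ * _); apply: eq_bigr => i _; rewrite mxE.
Qed.

(** Falling factorials are unitriangular combinations of powers, which reduces the determinant to
    Vandermonde's. *)
Lemma det_ffact (R : comNzRingType) (k : nat) (c : 'I_k -> nat) :
  \det (\matrix_(r < k, s < k) (c s ^_ r)%:R)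
    = \prod_(i < k) \prod_(j < k | (i < j)%N) ((c j)%:R - (c i)%:R) :> R.
Proof.
pose T : 'M[R]_k := \matrix_(r, j) (falling_poly R r)`_j.
pose a : 'rV[R]_k := \row_s (c s)%:R.
have -> : \matrix_(r < k, s < k) (c s ^_ r)%:R = T *m Vandermonde k a.
  apply/matrixP => r s; rewrite !mxE -horner_falling_poly horner_coef size_falling_poly.
  rewrite (big_ord_widen k (fun j => (falling_poly R r)`_j * (c s)%:R ^+ j)) //.
  rewrite big_mkcond; apply: eq_bigr => j _; rewrite !mxE.
  by case: leqP => // lt_rj; rewrite nth_default ?mul0r // size_falling_poly.
rewrite det_mulmx det_Vandermonde det_trig.
  rewrite big1 ?mul1r => [|i _].
    by apply: eq_bigr => i _; apply: eq_bigr => j _; rewrite !mxE.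
  by rewrite mxE coef_falling_poly.
by apply/is_trig_mxP => r j lt_rj; rewrite mxE nth_default ?size_falling_poly.
Qed.

(** * Invertible factorials and minors along a Jordan chain *)

Lemma natr_neq0_fact (F : fieldType) (d m : nat) :
  d`!%:R != 0 :> F -> (0 < m <= d)%N -> m%:R != 0 :> F.
Proof.
move=> fact_neq0 /dvdn_fact /dvdnP[q eq_q]; move: fact_neq0.
by rewrite eq_q natrM mulf_eq0 negb_or => /andP[].
Qed.

Lemma factr_neq0 (F : fieldType) (d m : nat) :
  d`!%:R != 0 :> F -> (m <= d)%N -> m`!%:R != 0 :> F.
Proof.
move=> + le_md; rewrite -(ffact_fact (leq_subr m d)) subKn // natrM mulf_eq0.
by rewrite negb_or => /andP[].
Qed.

Lemma sum_ord_support (R : nmodType) (m n : nat) (h : nat -> R) :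
  (forall j, (m <= j)%N -> h j = 0) -> (forall j, (n <= j)%N -> h j = 0) ->
  \sum_(j < m) h j = \sum_(j < n) h j.
Proof.
wlog le_mn : m n / (m <= n)%N => [IH hm hn|hm _].
  by case/orP: (leq_total m n) => [le_mn|le_nm]; [exact: IH|apply/esym/IH].
rewrite (big_ord_widen n h le_mn) big_mkcond; apply: eq_bigr => j _.
by case: leqP => // /hm.
Qed.

(** Determinants are used rather than powers of [wedge_mx], so that a change of basis or a lift from
    a quotient only modifies [X] and [Y]. *)
Definition poly_minor {F : fieldType} {n : nat} (A : 'M[F]_n) (k D : nat) : Prop :=
  exists (X : 'M[F]_(k, n)) (Y : 'M[F]_(n, k)) (f : {poly F}),
    [/\ (size f <= D.+1)%N, f`_D != 0
      & forall i : nat, \det (X *m A ^+ i *m Y) = f.[i%:R]].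

Lemma unipotent_orbit_poly (F : fieldType) (n d r b i : nat) (A : 'M[F]_n)
    (v : 'rV[F]_n) (phi : 'cV[F]_n) :
  d`!%:R != 0 :> F -> (forall e, (d < e)%N -> v *m (A - 1) ^+ e = 0) ->
  ((v *m (A - 1) ^+ r) *m A ^+ i *m ((A - 1) ^+ b *m phi)) 0 0
  = (\sum_(j < d.+1) ((v *m (A - 1) ^+ (j + r + b) *m phi) 0 0 / j`!%:R)
       *: falling_poly F j).[i%:R].
Proof.
move=> d_fact vN0.
have -> : A ^+ i = \sum_(j < i.+1) (A - 1) ^+ j *+ 'C(i, j).
  by rewrite -exprD1n subrK.
rewrite mulmx_sumr mulmx_suml summxE horner_sum.
rewrite (eq_bigr (fun j : 'I_i.+1 =>
   (v *m (A - 1) ^+ (j + r + b) *m phi) 0 0 *+ 'C(i, j))) => [|j _]; last first.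
  rewrite -scaler_nat -scalemxAr -scalemxAl mxE mulr_natl mulmxA.
  by rewrite (addnC j) !exprD -!mulmxE !mulmxA.
(* Terms beyond [i] vanish through the binomial coefficient and terms beyond [d] through [vN0], so
   the range can be made independent of [i], and only factorials up to [d!] are inverted. *)
rewrite (sum_ord_support _ _ d.+1
   (fun j => (v *m (A - 1) ^+ (j + r + b) *m phi) 0 0 *+ 'C(i, j))).
- apply: eq_bigr => j _; rewrite hornerZ horner_falling_poly -bin_ffact natrM.
  by rewrite mulrA mulrAC divfK ?mulr_natr // (factr_neq0 _ d) // -ltnS.
- by move=> j lt_ij; rewrite bin_small.
- by move=> j lt_dj; rewrite vN0 ?mul0mx ?mxE ?mul0rn // -addnA ltn_addr.
Qed.

Lemma jordan_chain_poly_minor (F : fieldType) (n k d D : nat) (A : 'M[F]_n)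
    (v : 'rV[F]_n) (phi : 'cV[F]_n) (c : 'I_k -> nat) :
  d`!%:R != 0 :> F -> (forall e, (d < e)%N -> v *m (A - 1) ^+ e = 0) ->
  (v *m (A - 1) ^+ d *m phi) 0 0 != 0 ->
  injective c -> (forall s, c s <= d)%N ->
  (\sum_s c s = D + \sum_(r < k) r)%N ->
  poly_minor A k D.
Proof.
move=> d_fact vN0 gd_neq0 c_inj le_cd sum_c.
pose g e := (v *m (A - 1) ^+ e *m phi) 0 0.
have g0 e : (d < e)%N -> g e = 0 by move=> lt_de; rewrite /g vN0 // mul0mx mxE.
pose E : 'M[{poly F}]_k := \matrix_(r, s)
  \sum_(j < d.+1) (g (j + r + (d - c s))%N / j`!%:R) *: falling_poly F j.
(* The entry [E r s] has degree at most [c s - r]; multiplying row [r] by ['X^r] makes the bound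
   depend on the column alone, as [size_coef_det] requires. *)
pose M : 'M[{poly F}]_k := \matrix_(r, s) ('X^r * E r s).
have detM : \det M = 'X^(\sum_(r < k) r) * \det E.
  have -> : M = diag_mx (\row_r 'X^r) *m E.
    by rewrite mul_diag_mx; apply/matrixP => r s; rewrite !mxE.
  rewrite det_mulmx det_diag; congr (_ * _).
  by rewrite -prodrXr; apply: eq_bigr => r _; rewrite mxE.
have size_M r s : (size (M r s) <= (c s).+1)%N.
  apply/leq_sizeP => e lt_ce; rewrite mxE coefXnM; case: ltnP => // le_re.
  rewrite mxE coef_sum big1 // => j _; rewrite coefZ.
  have [lt_j|le_j] := ltnP j (e - r); first by rewrite nth_default ?mulr0 ?size_falling_poly.
  by rewrite g0 ?mul0r //; have := le_cd s; lia.
(* Only [j = c s - r] contributes, with coefficient [g d / (c s - r)!]; for [c s < r] both sides are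
   zero. The factor [g d / (c s)!] then comes out of column [s]. *)
have coef_M r s : (M r s)`_(c s) = (c s ^_ r)%:R * (g d / (c s)`!%:R).
  rewrite mxE coefXnM; case: ltnP => [lt_cr|le_rc]; first by rewrite ffact_small ?mul0r.
  have lt_j : (c s - r < d.+1)%N by have := le_cd s; lia.
  rewrite mxE coef_sum (bigD1 (Ordinal lt_j)) //= big1 ?addr0.
    rewrite coefZ coef_falling_poly mulr1 subnK // subnKC //.
    rewrite -(ffact_fact le_rc) natrM.
    have := factr_neq0 _ _ _ d_fact (le_cd s).
    rewrite -(ffact_fact le_rc) natrM mulf_eq0 negb_or => /andP[fs0 fr0].
    by rewrite invfM mulrCA mulVKf.
  move=> j; rewrite -val_eqE /= coefZ => neq_j.
  have [lt_jc|le_cj] := ltnP j (c s - r); first by rewrite nth_default ?mulr0 ?size_falling_poly.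
  by rewrite g0 ?mul0r //; have := le_cd s; lia.
have [size_detM coef_detM] := size_coef_det _ _ _ _ size_M.
exists (\matrix_(r, a) (v *m (A - 1) ^+ r) 0 a).
exists (\matrix_(a, s) ((A - 1) ^+ (d - c s) *m phi) a 0).
exists (\det E); split.
- apply/leq_sizeP => e lt_De.
  have := leq_sizeP _ _ size_detM (e + \sum_(r < k) r)%N.
  by rewrite sum_c -addSn leq_add2r detM coefXnM [(_ < \sum_(_ < k) _)%N]ltnNge leq_addl addnK /= => ->.
- have -> : (\det E)`_D = (\det M)`_(\sum_s c s)%N.
    by rewrite sum_c detM coefXnM ltnNge leq_addl addnK.
  rewrite coef_detM.
  have -> : \matrix_(r, s) (M r s)`_(c s)
      = (\matrix_(r < k, s < k) (c s ^_ r)%:R) *m diag_mx (\row_s (g d / (c s)`!%:R)).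
    by rewrite mul_mx_diag; apply/matrixP => r s; rewrite [LHS]mxE coef_M !mxE.
  rewrite det_mulmx det_diag det_ffact mulf_neq0 //; apply/prodf_neq0 => i _.
    apply/prodf_neq0 => j lt_ij.
    have neq_c : c i != c j.
      by apply: contraTneq lt_ij => /c_inj ->; rewrite ltnn.
    (* The values [c s] need not increase with [s]; swapping [i] and [j] only changes the sign. A
       positive difference is at most [d], hence nonzero in [F]. *)
    wlog lt_c : i j neq_c {lt_ij} / (c i < c j)%N.
      move=> IH; case: (ltngtP (c i) (c j)) neq_c => // lt_c _; last rewrite -opprB oppr_eq0.
        by apply: IH; rewrite ?neq_ltn lt_c.
      by apply: IH; rewrite ?neq_ltn lt_c.
    rewrite -natrB 1?ltnW // (natr_neq0_fact _ d) // subn_gt0 lt_c.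
    by rewrite (leq_trans (leq_subr _ _)).
  by rewrite mxE mulf_neq0 // invr_neq0 // (factr_neq0 _ d).
move=> i.
have -> : (\matrix_(r < k, a < n) (v *m (A - 1) ^+ r) 0 a) *m A ^+ i
    *m (\matrix_(a < n, s < k) ((A - 1) ^+ (d - c s) *m phi) a 0)
    = map_mx (horner_eval i%:R) E.
  apply/matrixP => r s; rewrite [RHS]mxE [E r s]mxE [RHS]/horner_eval.
  rewrite -(unipotent_orbit_poly _ _ d r (d - c s) i) // [LHS]mxE [RHS]mxE.
  apply: eq_bigr => a _; congr (_ * _); last by rewrite mxE.
  by rewrite [LHS]mxE [RHS]mxE; apply: eq_bigr => b _; congr (_ * _); rewrite mxE.
by rewrite det_map_mx.
Qed.

(** * Change of basis and quotients by a fixed line *)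

Lemma unitmx_conj_exp (F : fieldType) (n i : nat) (A P : 'M[F]_n) :
  P \in unitmx -> (P *m A *m invmx P) ^+ i = P *m A ^+ i *m invmx P.
Proof.
move=> Pu; elim: i => [|i IHi]; first by rewrite !expr0 -idmxE mulmx1 mulmxV.
by rewrite !exprSr -!mulmxE IHi !mulmxA mulmxKV.
Qed.

Lemma poly_minor_conj (F : fieldType) (n k D : nat) (A P : 'M[F]_n) :
  P \in unitmx -> poly_minor (P *m A *m invmx P) k D -> poly_minor A k D.
Proof.
move=> Pu [X [Y [f [size_f fD fE]]]].
exists (X *m P), (invmx P *m Y), f; split=> // i; rewrite -fE.
by rewrite unitmx_conj_exp // !mulmxA.
Qed.

(** On row vectors this matrix fixes the first basis vector and acts as [A] on the quotient. The
    block [b'] stays unspecified because it drops out of the determinant in [poly_minor_block]. *)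
Lemma block_lunitri_exp (F : fieldType) (n i : nat) (b : 'cV[F]_n) (A : 'M[F]_n) :
  exists b' : 'cV[F]_n, (block_mx 1%:M 0 b A : 'M_(1 + n)) ^+ i = block_mx 1%:M 0 b' (A ^+ i).
Proof.
elim: i => [|i [b' IHi]].
  by exists 0; rewrite !expr0 -!idmxE -scalar_mx_block.
exists (b' + A ^+ i *m b); rewrite exprSr IHi -mulmxE mulmx_block.
by rewrite !mul0mx !mulmx0 !mulmx1 !addr0 add0r exprSr.
Qed.

Lemma block_strict_exp (F : fieldType) (n i : nat) (b : 'cV[F]_n) (A : 'M[F]_n) :
  exists b' : 'cV[F]_n,
    (block_mx 0 0 b A : 'M_(1 + n)) ^+ i.+1 = block_mx 0 0 b' (A ^+ i.+1).
Proof.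
elim: i => [|i [b' IHi]]; first by exists b; rewrite !expr1.
exists (A ^+ i.+1 *m b); rewrite exprSr IHi -mulmxE mulmx_block.
by rewrite !(mul0mx, mulmx0, addr0, add0r) (exprSr _ i.+1).
Qed.

(** Bordering [X] and [Y] by a 1 amounts to wedging with the fixed vector: the product is block
    lower triangular with corner 1, so the determinant keeps its value. *)
Lemma poly_minor_block (F : fieldType) (n k D : nat) (b : 'cV[F]_n) (A : 'M[F]_n) :
  poly_minor A k D -> poly_minor (block_mx 1%:M 0 b A : 'M_(1 + n)) (1 + k) D.
Proof.
move=> [X [Y [f [size_f fD fE]]]].
exists (block_mx 1%:M 0 0 X : 'M_(1 + k, 1 + n)), (block_mx 1%:M 0 0 Y : 'M_(1 + n, 1 + k)), f.
split=> // i; have [b' ->] := block_lunitri_exp F n i b A.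
rewrite !mulmx_block !(mul0mx, mulmx0, mulmx1, addr0, add0r).
by rewrite det_lblock det1 mul1r fE.
Qed.

(** Each further factor [N] lowers the rank by at most the dimension of its kernel. *)
Lemma rank_exp_ge (F : fieldType) (n j : nat) (N : 'M[F]_n) :
  (n <= \rank (N ^+ j) + j * \rank (kermx N))%N.
Proof.
elim: j => [|j IHj]; first by rewrite expr0 -idmxE mxrank1 mul0n addn0.
apply: leq_trans IHj _; rewrite exprSr -mulmxE -(mxrank_mul_ker (N ^+ j) N).
by rewrite mulSn -addnA leq_add2l leq_add2r mxrankS ?capmxSr.
Qed.

(* The image of [N ^+ d] lies in the line [u] only if they are equal.  If the
   kernel lies in that image, this forces both to be lines, and then
   [rank_exp_ge] gives [n <= d + 1]. *)
Lemma exists_fixed_line (F : fieldType) (n m d : nat) (N : 'M[F]_n) :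
  (d + 2 <= n)%N -> N ^+ m = 0 -> N ^+ d != 0 ->
  exists u : 'rV[F]_n, [/\ u != 0, u *m N = 0 & ~~ (N ^+ d <= u)%MS].
Proof.
move=> le_dn Nm0 Nd_neq0.
have [sub_ker|/row_subPn[i not_sub]] := boolP (kermx N <= N ^+ d)%MS.
  have /rowV0Pn[u u_ker u_neq0] : kermx N != 0.
    apply/eqP => ker0; have := rank_exp_ge F n m N.
    by rewrite Nm0 ker0 !mxrank0 muln0; lia.
  exists u; split=> //; first exact/sub_kermxP.
  apply/negP => sub_u; have := rank_exp_ge F n d N.
  have := mxrankS (submx_trans sub_ker sub_u); have := mxrankS sub_u.
  have := rank_leq_row u; nia.
exists (row i (kermx N)); split.
- by apply: contraNneq not_sub => ->; rewrite sub0mx.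
- by rewrite -row_mul mulmx_ker row0.
apply: contraNN not_sub => sub_u; rewrite -(geq_leqif (mxrank_leqif_sup sub_u)).
by apply: leq_trans (rank_leq_row _) _; rewrite lt0n mxrank_eq0.
Qed.

(** * Minors of exact degree for unipotent operators, and the conclusion *)

Lemma poly_minor_unipotent_small (F : fieldType) (n k d : nat) (A : 'M[F]_n) :
  d`!%:R != 0 :> F -> unipotent A -> (2 <= k < d)%N -> (A - 1) ^+ d != 0 ->
  poly_minor A k d.+1.
Proof.
move=> d_fact [m0 Nm0] /andP[le_2k lt_kd] Nd_neq0; set N := A - 1 in Nm0 Nd_neq0.
have exm : exists m, N ^+ m == 0 by exists m0; apply/eqP.
case: (ex_minnP exm) => m /eqP Nm min_m.
have lt_dm : (d < m)%N.
  rewrite ltnNge; apply: contra_neqN Nd_neq0 => le_md.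
  by rewrite -(subnKC le_md) exprD Nm mul0r.
have /matrix0Pn[i [j Nij]] : N ^+ m.-1 != 0.
  by apply/negP => /min_m; lia.
(* The values are [1, ..., k-2, k, d], distinct because [k < d]; their sum exceeds [0 + ... + (k-1)]
   by [k + d - (k-1) = d + 1]. *)
pose c (s : 'I_k) := (if s.+2 < k then s.+1 else if s.+2 == k then k else d)%N.
(* The start is chosen so that [v *m N ^+ d] is a row of [N ^+ m.-1], the last nonzero power. *)
pose v := row i (N ^+ (m.-1 - d)).
apply: (@jordan_chain_poly_minor _ _ _ d _ _ v (delta_mx j 0) c) => //.
- move=> e lt_de; rewrite -row_mul mulmxE -exprD -/N.
  have -> : (m.-1 - d + e = m + (e - d.+1))%N by lia.
  by rewrite exprD Nm mul0r row0.
- rewrite -row_mul mulmxE -exprD -/N subnK -?colE; last by lia.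
  by rewrite !mxE.
- move=> s t; rewrite /c => eq_c; apply/val_inj => /=.
  have := ltn_ord s; have := ltn_ord t; move: eq_c.
  by do 4?case: ifP; lia.
- by move=> s; rewrite /c; have := ltn_ord s; do 2?case: ifP; lia.
rewrite /c; case: k le_2k lt_kd {c} => [|[|k]] // _ lt_kd.
rewrite !big_ord_recr /= ltnn eqxx ltnNge ltnW //= gtn_eqF //.
rewrite (eq_bigr (fun s : 'I_k => s + 1)%N) => [|s _]; last first.
  by rewrite /= !ltnS ltn_ord addn1.
by rewrite big_split /= sum_nat_const card_ord; lia.
Qed.

(** Induction on [k]. Once [k >= d], a fixed line is factored out: [k + 2 <= n] then gives the bound
    [d + 2 <= n] of [exists_fixed_line], and [3 <= d] keeps the reduced [k] at least 2. *)
Lemma poly_minor_unipotent (F : fieldType) (n k d : nat) (A : 'M[F]_n) :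
  (3 <= d)%N -> d`!%:R != 0 :> F -> unipotent A -> (2 <= k)%N -> (k + 2 <= n)%N ->
  (A - 1) ^+ d != 0 -> poly_minor A k d.+1.
Proof.
move=> le_3d d_fact; elim: k n A => // k IHk n A unip le_2k le_kn Nd_neq0.
have [lt_kd|le_dk] := ltnP k.+1 d.
  by apply: poly_minor_unipotent_small; rewrite ?le_2k.
case: n => [|n] in A unip le_kn Nd_neq0 *; first by lia.
have [m Nm0] := unip.
have [|u [u_neq0 uN0 not_sub]] := exists_fixed_line F n.+1 m d (A - 1) _ Nm0 Nd_neq0.
  by lia.
have rank_u : \rank u = 1%N.
  by apply/eqP; rewrite eqn_leq rank_leq_row lt0n mxrank_eq0.
(* Since [u] has rank one, the first row of this invertible matrix spans the same line. *)
pose P : 'M_(1 + n) := row_ebase u.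
have Pu : P \in unitmx by exact: row_ebase_unit.
have [a uE] : exists a, u = a *: usubmx P.
  exists (col_ebase u 0 0); rewrite -[LHS]mulmx_ebase rank_u.
  rewrite -mul_scalar_mx -mx11_scalar -mulmxA; congr (_ *m _).
  rewrite -[row_ebase u]/P -[X in _ *m X]vsubmxK pid_mx_row.
  by rewrite (mul_row_col 1%:M 0 (usubmx P)) mul1mx mul0mx addr0.
have a_neq0 : a != 0 by apply: contraNneq u_neq0 => a0; rewrite uE a0 scale0r.
have P0N : usubmx P *m (A - 1) = 0.
  by apply/eqP; move: uN0; rewrite uE -scalemxAl => /eqP; rewrite scaler_eq0 (negPf a_neq0).
apply: (poly_minor_conj _ _ _ _ _ P) => //.
set C := P *m A *m invmx P.
pose b := dlsubmx (C : 'M_(1 + n)); pose A' := drsubmx (C : 'M_(1 + n)).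
have C1E : C - 1 = P *m (A - 1) *m invmx P.
  by rewrite -idmxE mulmxBr mulmxBl mulmx1 mulmxV.
have row0E : row_mx 1%:M 0 *m P = usubmx P.
  by rewrite -[P in LHS]vsubmxK mul_row_col mul1mx mul0mx addr0.
have C0 : row_mx 1%:M 0 *m C = row_mx 1%:M 0.
  rewrite -[C](subrK 1) C1E mulmxDr -idmxE mulmx1 !mulmxA row0E P0N.
  by rewrite mul0mx add0r.
have CE : C = block_mx 1%:M 0 b A' :> 'M_(1 + n).
  rewrite -[LHS]vsubmxK -[usubmx C]addr0 -[usubmx C]mul1mx -(mul0mx _ (dsubmx C)).
  by rewrite -mul_row_col vsubmxK C0 -[dsubmx C]hsubmxK.
have C1b : C - 1 = block_mx 0 0 b (A' - 1) :> 'M_(1 + n).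
  rewrite CE -idmxE (@scalar_mx_block _ 1 n) opp_block_mx add_block_mx.
  by rewrite subrr !oppr0 !addr0.
have A'unip : unipotent A'.
  (* The exponent is [m.+1] because [block_strict_exp] covers positive exponents only. *)
  exists m.+1; have [b' Cm] := block_strict_exp F n m b (A' - 1).
  rewrite -[LHS](block_mxKdr (0 : 'M_1) 0 b') -Cm -C1b C1E unitmx_conj_exp //.
  by rewrite exprS Nm0 mulr0 mulmx0 mul0mx; apply/matrixP => r s; rewrite !mxE.
have [b' Cd] : exists b', (C - 1) ^+ d = block_mx 0 0 b' ((A' - 1) ^+ d) :> 'M_(1 + n).
  by rewrite C1b; case: (d) le_3d => // d' _; apply: block_strict_exp.
rewrite CE; apply: (poly_minor_block F n k); apply: IHk => //; try lia.
(* If [(A' - 1) ^+ d] vanished, [(C - 1) ^+ d] would be zero outside its first column, and the image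
   of [(A - 1) ^+ d] would lie in the line of [u]. *)
apply: contraNneq not_sub => A'd0.
have -> : (A - 1) ^+ d = invmx P *m (C - 1) ^+ d *m P.
  by rewrite C1E unitmx_conj_exp // !mulmxA mulVmx // mul1mx mulmxKV.
have -> : (C - 1) ^+ d = col_mx 0 b' *m row_mx 1%:M 0.
  by rewrite Cd A'd0 mul_col_row !mul0mx mulmx1 mulmx0.
by rewrite -!mulmxA row0E mulmxA uE (eqmx_scale _ a_neq0) submxMl.
Qed.

Theorem theorem3p11 (F : fieldType) (l : nat) (n : nat) (A : 'M[F]_n) (k : nat) :
  l \in [pchar F] -> (5 <= l)%N ->
  unipotent A ->
  (2 <= k)%N -> (k <= n - 2)%N ->
  (A - 1) ^+ (l - 2) != 0 ->
  (wedge_mx k A - 1) ^+ (l - 1) != 0.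
Proof.
move=> char_l le_5l unip le_2k le_kn Nd_neq0.
have fact_neq0 m : (m < l)%N -> m`!%:R != 0 :> F.
  elim: m => [|m IHm] lt_ml; first by rewrite fact0 oner_eq0.
  rewrite factS natrM mulf_neq0 ?IHm 1?ltnW // -(dvdn_pcharf char_l).
  by rewrite gtnNdvd.
have [|||X [Y [f [size_f f_neq0 fE]]]] :=
    poly_minor_unipotent F n k (l - 2) A _ _ unip le_2k _ Nd_neq0;
  [by lia|by apply: fact_neq0; lia|by lia|].
(* With [d = l - 2], the degree [d + 1] is exactly the exponent in the goal. *)
have l1E : (l - 2).+1 = (l - 1)%N by lia.
rewrite l1E in size_f f_neq0.
apply/eqP => wedge0.
(* The vanishing matrix coefficient equals the coefficient of [f] in degree [l - 1] times
   [(l - 1)!], and both factors are nonzero in [F]. *)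
have := poly_seq_difference _ _ _ (wedge_mx k A) _ _ _ size_f
  (fun i => etrans (wedge_mxX_minors _ _ _ _ X Y i) (fE i)).
rewrite wedge0 mulmx0 mul0mx mxE => /esym/eqP.
by rewrite -mulr_natr mulf_eq0 (negPf f_neq0) (negPf (fact_neq0 _ _)) //; lia.
Qed.
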